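(* Assume the reconstruction conjecture is true. Then for all finite undirected graphs $G$ and $H$ with $G\not\cong H$, player $\forall$ has a winning strategy in the Seurat game $\mathbf{G}^3(G,H)$ (the game with $3$ colours).
   Context: Graphs are finite, undirected, without multiple edges (loops allowed); a graph is identified with its vertex set, and an undirected edge $\{u,v\}$ is regarded as edges in both directions. For a vertex $u$ of $G$, $G\setminus\{u\}$ is the induced subgraph on the remaining vertices. Reconstruction conjecture: if $G$ and $H$ are non-isomorphic (undirected) graphs, at least one having at least three vertices, then there is a graph $F$ such that the number of vertices $u$ of $G$ with $G\setminus\{u\}\cong F$ differs from the number of vertices $v$ of $H$ with $H\setminus\{v\}\cong F$. Seurat game $\mathbf{G}^k(G,H)$: two players $\forall$ and $\exists$, a set $\mathbf{Col}$ of $k$ colours. A position is a pair of functions $g:\mathbf{Col}\to\wp(G)$, $h:\mathbf{Col}\to\wp(H)$; initially every colour is assigned the empty set. There are $\omega$ rounds. In each round $\forall$ chooses a colour $c$, one of the two graphs, and a subset of its vertices; then $\exists$ chooses a subset of the vertices of the other graph; the new position agrees with the old one except that $c$ is now assigned the two chosen sets (erasing its previous use). The palette of a vertex is the set of colours whose assigned set contains it; for $P\subseteq\mathbf{Col}$, $P^G$ (resp. $P^H$) is the set of vertices with palette exactly $P$. $\forall$ wins in round $n$ if at the beginning of that round either (C1) some palette $P$ has $P^G$ empty and $P^H$ nonempty or vice versa, or (C2) there are palettes $P_1,P_2$ with an edge from $P_1^G$ to $P_2^G$ but none from $P_1^H$ to $P_2^H$, or vice versa. $\forall$ has a winning strategy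 if he can guarantee a win in finitely many rounds. *)

(* Defs.v *)
From mathcomp Require Import all_boot.

Set Implicit Arguments.
Unset Strict Implicit.
Unset Printing Implicit Defensive.

(* Loops are allowed: [edge] is not required to be irreflexive. *)
Record graph := Graph {
  vertex :> finType;
  edge : rel vertex;
  edge_sym : symmetric edge
}.

Definition isomorphic (G H : graph) : Prop :=
  exists f : G -> H,
    bijective f /\ (forall x y : G, edge (f x) (f y) = edge x y).

(* Boolean counterpart of [isomorphic] (see [isomorphicP]), used for counting. *)
Definition isomorphicb (G H : graph) : bool :=
  [exists f : {ffun G -> H}, exists g : {ffun H -> G},
    [&& [forall x, g (f x) == x], [forall y, f (g y) == y]
      & [forall x, forall y, edge (f x) (f y) == edge x y]]].

Lemma isomorphicP (G H : graph) : reflect (isomorphic G H) (isomorphicb G H).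
Proof.
apply: (iffP existsP) => [[f /existsP[g /and3P[/forallP fK /forallP gK]]]|].
  move=> /forallP fE; exists f; split=> [|x y].
    by exists g => x; apply/eqP; [apply: fK|apply: gK].
  by apply/eqP; move/forallP: (fE x); apply.
move=> [f [[g fK gK] fE]]; exists (finfun f); apply/existsP; exists (finfun g).
apply/and3P; split; apply/forallP => x; first by rewrite !ffunE fK.
  by rewrite !ffunE gK.
by apply/forallP => y; rewrite !ffunE fE.
Qed.

Section VertexDeletion.
Variables (G : graph) (u : G).

Definition del_edge : rel {v : G | v != u} :=
  fun x y => edge (val x) (val y).

Lemma del_edge_sym : symmetric del_edge.
Proof. by move=> x y; apply: edge_sym. Qed.

Definition del_vertex : graph := Graph del_edge_sym.

End VertexDeletion.

Definition reconstruction_conjecture : Prop :=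
  forall G H : graph,
    ~ isomorphic G H -> 3 <= #|G| \/ 3 <= #|H| ->
    exists F : graph,
      #|[set u : G | isomorphicb (del_vertex u) F]|
      <> #|[set v : H | isomorphicb (del_vertex v) F]|.

Definition colouring (k : nat) (G : graph) : Type := {ffun 'I_k -> {set G}}.

Definition palette (k : nat) (G : graph) (g : colouring k G) (x : G) :
    {set 'I_k} :=
  [set c | x \in g c].

Definition palette_class (k : nat) (G : graph) (g : colouring k G)
    (P : {set 'I_k}) : {set G} :=
  [set x | palette g x == P].

Definition recolour (k : nat) (G : graph) (g : colouring k G) (c : 'I_k)
    (A : {set G}) : colouring k G :=
  [ffun d => if d == c then A else g d].

Definition has_edge (G : graph) (A B : {set G}) : Prop :=
  exists x y : G, [/\ x \in A, y \in B & edge x y].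

Section SeuratGame.
Variables (k : nat) (G H : graph).

Definition position : Type := (colouring k G * colouring k H)%type.

Definition initial_position : position :=
  ([ffun=> set0], [ffun=> set0]).

(* A move of the first player: a colour together with a set of vertices of
   one of the two graphs. *)
Definition move : Type := ('I_k * ({set G} + {set H}))%type.

(* [round p m q]: the second player can answer the move [m] made in position
   [p] so that the new position is [q]. *)
Definition round (p : position) (m : move) (q : position) : Prop :=
  match m with
  | (c, inl A) => exists B : {set H}, q = (recolour p.1 c A, recolour p.2 c B)
  | (c, inr B) => exists A : {set G}, q = (recolour p.1 c A, recolour p.2 c B)
  end.

Definition condition1 (p : position) : Prop :=
  exists P : {set 'I_k},
    (palette_class p.1 P = set0 /\ palette_class p.2 P <> set0) \/
    (palette_class p.1 P <> set0 /\ palette_class p.2 P = set0).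

Definition condition2 (p : position) : Prop :=
  exists P1 P2 : {set 'I_k},
    let eG := has_edge (palette_class p.1 P1) (palette_class p.1 P2) in
    let eH := has_edge (palette_class p.2 P1) (palette_class p.2 P2) in
    (eG /\ ~ eH) \/ (~ eG /\ eH).

Definition wins_at (p : position) : Prop := condition1 p \/ condition2 p.

(* A strategy of the first player reads the positions reached so far, in
   chronological order and including the current one.  His own earlier moves
   are determined by the strategy, so this is the full history of the play. *)
Definition strategy : Type := seq position -> move.

(* Plays are continued for ever, also after a winning position. *)
Definition consistent_play (s : strategy) (p : nat -> position) : Prop :=
  p 0 = initial_position /\
  forall n, round (p n) (s (mkseq p n.+1)) (p n.+1).

Definition winning_strategy (s : strategy) : Prop :=
  forall p : nat -> position, consistent_play s p -> exists n, wins_at (p n).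

Definition forall_has_winning_strategy : Prop :=
  exists s : strategy, winning_strategy s.

End SeuratGame.

(* Main.v *)
(** Induct on the vertex sets still in play.  Suppose that one colour marks
    [X] in [G] and [Y] in [H], and that the induced subgraphs are not
    isomorphic.  As long as one of them has three vertices, the reconstruction
    conjecture gives [F] such that, say, the set [A] of the [u] in [X] with
    [X \ u] isomorphic to [F] is larger than the corresponding subset of [Y].
    The first player marks [A] with a second colour.  Marked sets of different
    sizes can be told apart, so the reply [B] has the size of [A] and contains
    some [v] such that [Y \ v] is not isomorphic to [F].  He marks [v] with the
    third colour; the reply is some [u] in [A].  Now the second colour, whose
    information is no longer needed, can be moved to [X \ u], the reply
    [Y \ v] being forced, and the other two colours are free again. *)
Require Import Defs.
From mathcomp Require Import all_boot.

Set Implicit Arguments.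
Unset Strict Implicit.
Unset Printing Implicit Defensive.

Lemma isomorphic_sym (G H : graph) : isomorphic G H -> isomorphic H G.
Proof.
move=> [f [[g fK gK] fE]]; exists g; split; first by exists f.
by move=> x y; rewrite -fE !gK.
Qed.

Lemma isomorphic_trans (G H K : graph) :
  isomorphic G H -> isomorphic H K -> isomorphic G K.
Proof.
move=> [f [f_bij fE]] [g [g_bij gE]]; exists (g \o f); split=> [|x y /=].
  exact: bij_comp.
by rewrite gE fE.
Qed.

Lemma isomorphicb_congr (G H F : graph) :
  isomorphic G H -> isomorphicb G F = isomorphicb H F.
Proof.
move=> GH; apply/isomorphicP/isomorphicP; apply: isomorphic_trans => //.
exact: isomorphic_sym.
Qed.

(** * Induced subgraphs and their decks *)

Section Induced.
Variables (G : graph) (X : {set G}).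

Definition induced_edge : rel {x : G | x \in X} :=
  fun x y => edge (val x) (val y).

Lemma induced_edge_sym : symmetric induced_edge.
Proof. by move=> x y; apply: edge_sym. Qed.

Definition induced : graph := Graph induced_edge_sym.

Lemma card_induced : #|induced| = #|X|.
Proof. by rewrite card_sig. Qed.

Lemma mem_induced (x : induced) : val x \in X.
Proof. exact: valP x. Qed.

End Induced.

(** The images in [G] agree, so one embedding followed by the inverse of the other is an
    isomorphism. This spares explicit maps between nested subtypes. *)
Lemma isomorphic_bij_val (G K L : graph) (i : K -> G) (j : L -> G) :
    injective i -> injective j ->
    (forall x y, edge (i x) (i y) = edge x y) ->
    (forall x y, edge (j x) (j y) = edge x y) ->
    (forall x, exists y, j y = i x) -> (forall y, exists x, i x = j y) ->
  isomorphic K L.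
Proof.
move=> i_inj j_inj iE jE /fin_all_exists[f fE] /fin_all_exists[g gE].
exists f; split; last by move=> x y; rewrite -jE !fE iE.
by exists g => x; [apply: i_inj; rewrite gE fE | apply: j_inj; rewrite fE gE].
Qed.

Lemma induced_setT (G : graph) : isomorphic G (induced [set: G]).
Proof.
apply: (@isomorphic_bij_val G G (induced setT) id val) => // [|x|y].
- exact: val_inj.
- by exists (Sub x (in_setT x)).
- by exists (val y).
Qed.

Lemma del_vertex_induced (G : graph) (X : {set G}) (u : induced X) :
  isomorphic (del_vertex u) (induced (X :\ val u)).
Proof.
apply: (@isomorphic_bij_val G (del_vertex u) (induced (X :\ val u))
  (val \o val) val) => //.
- exact: inj_comp val_inj val_inj.
- exact: val_inj.
- move=> x; have xX : val (val x) \in X :\ val u.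
    by rewrite !inE (mem_induced (val x)) andbT; exact: valP x.
  by exists (Sub (val (val x)) xX).
- move=> y; have /setD1P[yu yX] := mem_induced y.
  have zu : Sub (val y) yX != u by [].
  by exists (Sub (Sub (val y) yX) zu).
Qed.

(** Turns the counts of the reconstruction conjecture into sizes of vertex sets of [G], which a
    colour can mark. *)
Lemma card_induced_deck (G F : graph) (X : {set G}) :
  #|[set u : induced X | isomorphicb (del_vertex u) F]|
  = #|[set x in X | isomorphicb (induced (X :\ x)) F]|.
Proof.
rewrite -(card_imset _ val_inj); congr #|pred_of_set _|; apply/setP=> x.
rewrite inE; apply/imsetP/andP => [[u]|[xX xF]].
  rewrite inE (isomorphicb_congr _ (del_vertex_induced u)) => uF ->.
  by split=> //; exact: mem_induced.
exists (Sub x xX) => //.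
by rewrite inE (isomorphicb_congr _ (del_vertex_induced _)).
Qed.

(** * Undecided positions and the winning region *)

Section Game.
Variable k : nat.

Definition alive (G H : graph) (p : position k G H) : Prop :=
  (forall P, (palette_class p.1 P == set0) = (palette_class p.2 P == set0)) /\
  (forall P1 P2, has_edge (palette_class p.1 P1) (palette_class p.1 P2)
             <-> has_edge (palette_class p.2 P1) (palette_class p.2 P2)).

Lemma has_edgeP (G : graph) (A B : {set G}) :
  reflect (has_edge A B) [exists x in A, exists y in B, edge x y].
Proof.
apply: (iffP exists_inP) => [[x xA /exists_inP[y yB xy]]|[x [y [xA yB xy]]]].
  by exists x, y.
by exists x => //; apply/exists_inP; exists y.
Qed.

(** Palettes and vertices range over finite types, so both winning conditions can be decided. *)
Lemma wins_at_or_alive (G H : graph) (p : position k G H) :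
  wins_at p \/ alive p.
Proof.
have [/forallP eqC1|/forallPn[P]] := boolP [forall P,
  (palette_class p.1 P == set0) == (palette_class p.2 P == set0)]; last first.
  move=> neq; left; left; exists P; move: neq.
  by case: (palette_class p.1 P =P set0) => ?;
    case: (palette_class p.2 P =P set0) => // ? _; [left|right].
pose he (K : graph) (g : colouring k K) P :=
  [exists x in palette_class g P.1, exists y in palette_class g P.2, edge x y].
have [/forallP eqC2|/forallPn[[P1 P2]]] :=
  boolP [forall P, he _ p.1 P == he _ p.2 P].
  right; split=> [P|P1 P2]; first exact: eqP (eqC1 P).
  have /eqP := eqC2 (P1, P2); rewrite /he /= => eq_he.
  by split=> /has_edgeP edgeP; apply/has_edgeP; move: edgeP; rewrite eq_he.
move=> neq; left; right; exists P1, P2; move: neq; rewrite /he /=.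
by case: has_edgeP => ?; case: has_edgeP => // ? _; [left|right].
Qed.

(** The winning region as a least fixed point: a derivation is a well-founded game tree. *)
Inductive winning (G H : graph) (p : position k G H) : Prop :=
| winning_now of wins_at p
| winning_left c A of
    (forall B, winning (recolour p.1 c A, recolour p.2 c B))
| winning_right c B of
    (forall A, winning (recolour p.1 c A, recolour p.2 c B)).

Lemma winning_alive (G H : graph) (p : position k G H) :
  (alive p -> winning p) -> winning p.
Proof.
by case: (wins_at_or_alive p) => [/winning_now|? win_p] //; apply: win_p.
Qed.

Lemma wins_at_swap (G H : graph) (p : position k G H) :
  wins_at p -> wins_at ((p.2, p.1) : position k H G).
Proof.
case=> [[P hP]|[P1 [P2 hP]]]; first by left; exists P => /=; tauto.
by right; exists P1, P2 => /=; move: hP => /=; tauto.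
Qed.

Lemma winning_swap (G H : graph) (p : position k G H) :
  winning p -> winning ((p.2, p.1) : position k H G).
Proof.
elim=> {p} p; first by move=> /wins_at_swap; apply: winning_now.
  by move=> c A _ IH; apply: (@winning_right _ _ _ c A).
by move=> c B _ IH; apply: (@winning_left _ _ _ c B).
Qed.

(** * Relations between colours that a reply must preserve *)

Definition def_set (G : graph) (g : colouring k G) (Q : pred {set 'I_k}) :
    {set G} :=
  [set x | Q (palette g x)].

(** Each [def_set] is a union of palette classes, and the same palettes have empty classes on both
    sides. *)
Lemma def_set_eq0 (G H : graph) (p : position k G H) Q :
  alive p -> (def_set p.1 Q == set0) = (def_set p.2 Q == set0).
Proof.
case=> eqC1 _.
have def0 (K : graph) (g : colouring k K) :
    (def_set g Q == set0) = [forall P, Q P ==> (palette_class g P == set0)].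
  apply/eqP/forallP => [Q0 P|Q0].
    apply/implyP=> QP; apply/eqP/setP=> x; rewrite !inE; apply/eqP=> xP.
    by move/setP/(_ x): Q0; rewrite !inE xP QP.
  apply/setP=> x; rewrite !inE; apply: contraTF (Q0 (palette g x)) => ->.
  by apply/set0Pn; exists x; rewrite inE.
by rewrite !def0; apply: eq_forallb => P; rewrite eqC1.
Qed.

(** Inclusion means that no palette in use contains [c] but not [d]. *)
Lemma alive_subset (G H : graph) (p : position k G H) c d :
  alive p -> (p.1 c \subset p.1 d) = (p.2 c \subset p.2 d).
Proof.
move=> /(def_set_eq0 (fun P : {set 'I_k} => (c \in P) && (d \notin P))).
rewrite -!setD_eq0; congr (_ = _); congr (_ == _).
  by apply/setP=> x; rewrite !inE andbC.
by apply/setP=> x; rewrite !inE andbC.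
Qed.

Lemma alive_setD (G H : graph) (p : position k G H) c d e :
  alive p -> p.1 d = p.1 c :\: p.1 e -> p.2 d = p.2 c :\: p.2 e.
Proof.
(* [Q] selects the symmetric difference of the two sides of the equation. *)
pose Q (P : {set 'I_k}) := (d \in P) != (c \in P) && (e \notin P).
move=> /(def_set_eq0 Q) eqQ def_d.
have /eqP Q0 : def_set p.2 Q == set0.
  rewrite -eqQ; apply/eqP/setP=> x; rewrite inE /Q !inE def_d !inE.
  by rewrite andbC eqxx.
apply/setP=> y; move/setP/(_ y): Q0.
by rewrite inE /Q !inE => /negbFE/eqP->; apply: andbC.
Qed.

Lemma alive_setT (G H : graph) (p : position k G H) c :
  alive p -> p.1 c = setT -> p.2 c = setT.
Proof.
pose Q (P : {set 'I_k}) := c \notin P.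
move=> /(def_set_eq0 Q) eqQ def_c.
have /eqP Q0 : def_set p.2 Q == set0.
  by rewrite -eqQ; apply/eqP/setP=> x; rewrite inE /Q !inE def_c inE.
by apply/setP=> y; move/setP/(_ y): Q0; rewrite inE /Q !inE => /negbFE.
Qed.

(** * Winning by unequal sizes and on small sets *)

Lemma recolour_same (G : graph) (g : colouring k G) c A :
  recolour g c A c = A.
Proof. by rewrite ffunE eqxx. Qed.

Lemma recolour_other (G : graph) (g : colouring k G) c d A :
  d != c -> recolour g c A d = g d.
Proof. by rewrite ffunE => /negbTE->. Qed.

(* The first player removes one vertex from the larger set; the second player
   has to answer with a proper subset of the smaller one. *)
Lemma winning_card_lt (G H : graph) (p : position k G H) c d :
  c != d -> #|p.1 c| < #|p.2 c| -> winning p.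
Proof.
have [n] := ubnP #|p.1 c|; elim: n => // n IH in p c d * => le_n ne_cd lt_c.
have [y yc] : exists y, y \in p.2 c.
  by apply/set0Pn; rewrite -card_gt0; apply: leq_ltn_trans lt_c.
apply: (@winning_right _ _ _ d (p.2 c :\ y)) => A; apply: winning_alive => al.
have := alive_subset c d al; have := alive_subset d c al.
rewrite /= !recolour_same !recolour_other // subsetDl => sAc.
have -> : (p.2 c \subset p.2 c :\ y) = false.
  by apply/negbTE/subsetPn; exists y; rewrite // !inE eqxx.
move=> nscA; have ltA : #|A| < #|p.1 c|.
  by rewrite proper_card // properE sAc nscA.
(* The colours exchange roles: [d] now marks [A] and a set of size [#|p.2 c| - 1], and
   [#|A| < #|p.1 c| <= #|p.2 c| - 1]. *)
apply: (IH _ d c); rewrite ?recolour_same 1?eq_sym //=.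
  exact: leq_trans ltA le_n.
by rewrite (leq_trans ltA) // -ltnS (leq_trans lt_c) // (cardsD1 y) yc.
Qed.

Lemma winning_card (G H : graph) (p : position k G H) c d :
  c != d -> #|p.1 c| != #|p.2 c| -> winning p.
Proof.
move=> ne_cd; rewrite neq_ltn => /orP[|lt_c].
  exact: winning_card_lt ne_cd.
by case: p lt_c => g h lt_c; apply: (@winning_swap H G (h, g));
  apply: winning_card_lt ne_cd _.
Qed.

(** The first condition matches each vertex of [p.1 c] with one of the same palette. Distinct
    palettes and equal sizes make this a bijection and the classes concerned singletons, so the
    second condition compares single edges. *)
Lemma alive_isomorphic (G H : graph) (p : position k G H) c :
    alive p -> #|p.1 c| = #|p.2 c| ->
    {in p.1 c &, injective (palette p.1)} ->
  isomorphic (induced (p.1 c)) (induced (p.2 c)).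
Proof.
move=> [eqC1 eqC2] eq_card inj_pal.
have [|r rE] := @fin_all_exists (induced (p.1 c)) (fun=> induced (p.2 c))
    (fun x y => palette p.2 (val y) = palette p.1 (val x)).
  move=> x; have /set0Pn[y] : palette_class p.2 (palette p.1 (val x)) != set0.
    by rewrite -eqC1; apply/set0Pn; exists (val x); rewrite inE.
  rewrite inE => /eqP yx.
  have yc : y \in p.2 c.
    by have := mem_induced x; move/setP/(_ c): yx; rewrite !inE => ->.
  by exists (Sub y yc).
have pal_inj (x x' : induced (p.1 c)) :
    palette p.1 (val x) = palette p.1 (val x') -> x = x'.
  by move=> eqx; apply: val_inj; apply: inj_pal eqx; apply: mem_induced.
have r_inj : injective r by move=> x x' eqr; apply: pal_inj; rewrite -!rE eqr.
have r_bij : bijective r.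
  by apply: inj_card_bij => //; rewrite !card_induced eq_card.
have unique_r y (x : induced (p.1 c)) :
    palette p.2 y = palette p.1 (val x) -> y = val (r x).
  move=> yx; have yc : y \in p.2 c.
    by have := mem_induced x; move/setP/(_ c): yx; rewrite !inE => ->.
  have [r' _ r'K] := r_bij; have := r'K (Sub y yc); set x' := r' _ => x'y.
  suff <- : x' = x by rewrite x'y.
  by apply: pal_inj; rewrite -yx -rE x'y.
have unique_val x' (x : induced (p.1 c)) :
    palette p.1 x' = palette p.1 (val x) -> x' = val x.
  move=> eqx; apply: inj_pal (eqx); last exact: mem_induced.
  by have := mem_induced x; move/setP/(_ c): eqx; rewrite !inE => ->.
exists r; split=> // x x'.
pose P1 := palette p.1 (val x); pose P2 := palette p.1 (val x').
apply/idP/idP => xx'.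
  have /eqC2[y [y' []]] :
      has_edge (palette_class p.2 P1) (palette_class p.2 P2).
    by exists (val (r x)), (val (r x')); rewrite !inE !rE !eqxx.
  by rewrite !inE => /eqP/unique_val-> /eqP/unique_val->.
have /eqC2[y [y' []]] : has_edge (palette_class p.1 P1) (palette_class p.1 P2).
  by exists (val x), (val x'); rewrite !inE !eqxx.
by rewrite !inE => /eqP/unique_r-> /eqP/unique_r->.
Qed.

(** Marking one of at most two vertices with [d] gives them distinct palettes. *)
Lemma winning_small (G H : graph) (p : position k G H) c d :
    c != d -> #|p.1 c| <= 2 ->
    ~ isomorphic (induced (p.1 c)) (induced (p.2 c)) ->
  winning p.
Proof.
move=> ne_cd le2 niso.
have [eq_card|] := eqVneq #|p.1 c| #|p.2 c|; last exact: winning_card ne_cd.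
have [D injD] : exists D : {set G}, {in p.1 c &, injective (mem D)}.
  have [->|[x xc]] := set_0Vmem (p.1 c).
    by exists set0 => x y; rewrite inE.
  exists [set x] => y z yc zc /=; rewrite !inE.
  have [->|yx] := eqVneq y x; first by case: eqVneq.
  have [//|zx _] := eqVneq z x.
  have le1 : #|p.1 c :\ x| <= 1 by move: le2; rewrite (cardsD1 x) xc.
  by apply: (card_le1_eqP le1); rewrite !inE ?yx ?zx.
apply: (@winning_left _ _ _ d D) => B; apply: winning_alive => al.
case: niso; have := alive_isomorphic (c := c) al.
rewrite /= !recolour_other //; apply=> // x y xc yc /setP/(_ d).
by rewrite !inE recolour_same; apply: injD.
Qed.

(** * Descent through the reconstruction conjecture *)

(** The inductive step. The last hypothesis carries both size bounds so that the graphs can be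
    exchanged in applications. *)
Lemma winning_deck_lt (G H F : graph) (p : position k G H) c d e :
    c != d -> c != e -> d != e ->
    #|[set y in p.2 c | isomorphicb (induced (p.2 c :\ y)) F]|
      < #|[set x in p.1 c | isomorphicb (induced (p.1 c :\ x)) F]| ->
    (forall q : position k G H, #|q.1 d| < #|p.1 c| -> #|q.2 d| < #|p.2 c| ->
       ~ isomorphic (induced (q.1 d)) (induced (q.2 d)) -> winning q) ->
  winning p.
Proof.
move=> ne_cd ne_ce ne_de; set A := [set x in p.1 c | _] => ltA win_smaller.
apply: (@winning_left _ _ _ d A) => B.
apply: winning_alive => al_d; have := alive_subset d c al_d.
rewrite /= !recolour_same !recolour_other //.
rewrite {1}/A setIdE subsetIl => /esym sBc.
have [eqB|neB] := eqVneq #|A| #|B|; last first.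
  by apply: (@winning_card _ _ _ d c); rewrite ?recolour_same // eq_sym.
(* Otherwise [B] would lie in the set counted in [H], which is smaller than [A]. *)
have [v vB vF] : exists2 v, v \in B & ~~ isomorphicb (induced (p.2 c :\ v)) F.
  apply/exists_inP; rewrite -negb_forall_in; apply: contraL ltA.
  move=> /forall_inP BF; rewrite -leqNgt eqB; apply/subset_leq_card/subsetP.
  by move=> y yB; rewrite inE (subsetP sBc) //= BF.
apply: (@winning_right _ _ _ e [set v]) => E; apply: winning_alive => al_e.
have := alive_subset e d al_e.
rewrite /= !recolour_same !(@recolour_other _ _ e d) // !recolour_same.
rewrite sub1set vB => sEA.
(* A reply that is not a singleton loses by size, with [c] as the spare colour. *)
have [|neE] := eqVneq #|E| 1; last first.
  apply: (@winning_card _ _ _ e c); first by rewrite eq_sym.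
  by rewrite /= !recolour_same cards1.
move/eqP/cards1P=> [u defE]; rewrite {E}defE sub1set in sEA al_e *.
have [uc uF] : u \in p.1 c /\ isomorphicb (induced (p.1 c :\ u)) F.
  by apply/andP; move: sEA; rewrite inE.
have vc : v \in p.2 c by apply: (subsetP sBc).
(* Colours [c] and [e] are still in place, so they determine the reply. *)
apply: (@winning_left _ _ _ d (p.1 c :\ u)) => Y; apply: winning_alive => al.
have defY : Y = p.2 c :\ v.
  have := @alive_setD _ _ _ c d e al; rewrite /= !recolour_same.
  rewrite !(@recolour_other _ _ d) 1?[e == d]eq_sym // !recolour_same.
  by rewrite !(@recolour_other _ _ e c) // !(@recolour_other _ _ d c) //; apply.
apply: win_smaller; rewrite /= !recolour_same ?defY.
- by rewrite [in X in _ < X](cardsD1 u) uc.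
- by rewrite [in X in _ < X](cardsD1 v) vc.
- by move/isomorphicb_congr => /(_ F); rewrite uF (negbTE vF).
Qed.

(** Induction on [#|p.1 c|]; after each descent [d] marks the current sets and [c] is free, so these
    two exchange roles. *)
Lemma winning_induced (G H : graph) (p : position k G H) c d e :
    reconstruction_conjecture -> c != d -> c != e -> d != e ->
    ~ isomorphic (induced (p.1 c)) (induced (p.2 c)) ->
  winning p.
Proof.
move=> hRC; have [n] := ubnP #|p.1 c|.
elim: n => // n IH in p c d e * => le_n ne_cd ne_ce ne_de niso.
have [le2|gt2] := leqP #|p.1 c| 2; first exact: winning_small ne_cd le2 niso.
have ne_dc : d != c by rewrite eq_sym.
have [|F] := hRC _ _ niso; first by left; rewrite card_induced.
rewrite !card_induced_deck => /eqP; rewrite neq_ltn => /orP[ltA|ltA].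
  (* Here the larger count lies in [H]. *)
  case: p => g h /= in le_n niso gt2 ltA *; apply: (@winning_swap H G (h, g)).
  apply: (@winning_deck_lt _ _ F (h, g) c d e) => // -[h' g'] /= _ lt niso'.
  apply: (@winning_swap G H (g', h')).
  apply: (IH _ d c e) => //; first exact: leq_trans lt _.
  by move=> /isomorphic_sym.
apply: (@winning_deck_lt _ _ F p c d e) => // q lt _ niso'.
by apply: (IH _ d c e) => //; exact: leq_trans lt _.
Qed.

(** * From game trees to strategies *)

Definition wins_from (G H : graph) (s : strategy k G H) (p0 : position k G H) :
    Prop :=
  forall p : nat -> position k G H, p 0 = p0 ->
    (forall n, round (p n) (s (mkseq p n.+1)) (p n.+1)) ->
  exists n, wins_at (p n).

Lemma mkseqSl (T : Type) (f : nat -> T) n :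
  mkseq f n.+1 = f 0 :: mkseq (f \o succn) n.
Proof. by rewrite /mkseq /= -[1]addn0 iotaDl -map_comp. Qed.

(** The position reached after [m] selects, through [i], the strategy for the rest of the play,
    which reads the history without its first entry. *)
Lemma wins_from_step (G H : graph) (I : Type) (p0 : position k G H)
    (m : move k G H) (S : I -> strategy k G H) (i : position k G H -> I) :
    (forall q, round p0 m q -> wins_from (S (i q)) q) ->
  exists s, wins_from s p0.
Proof.
move=> winS.
exists (fun t => if t is _ :: (q :: _) as t' then S (i q) t' else m).
move=> p p00 play; have := play 0; rewrite p00 => /winS win1.
have [|n pn] := win1 (p \o succn) erefl; last by exists n.+1.
by move=> n; have := play n.+1; rewrite mkseqSl.
Qed.

(** Strategies are total, so [m] serves as the default move once the play is won. *)
Lemma winning_wins_from (G H : graph) (p : position k G H) (m : move k G H) :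
  winning p -> exists s, wins_from s p.
Proof.
elim=> {p} p => [wp|c A _ IH|c B _ IH].
- by exists (fun=> m) => q q0 _; exists 0; rewrite q0.
- have [S winS] := fin_all_exists IH.
  apply: (@wins_from_step _ _ _ p (c, inl A) S (fun q => q.2 c)) => q [B ->].
  by rewrite recolour_same.
- have [S winS] := fin_all_exists IH.
  apply: (@wins_from_step _ _ _ p (c, inr B) S (fun q => q.1 c)) => q [A ->].
  by rewrite recolour_same.
Qed.

End Game.

Theorem theorem8p3 (hRC : reconstruction_conjecture) (G H : graph)
    (hGH : ~ isomorphic G H) :
  forall_has_winning_strategy 3 G H.
Proof.
pose c : 'I_3 := ord0; pose d : 'I_3 := lift ord0 ord0; pose e : 'I_3 := ord_max.
have [|s win_s] := @winning_wins_from 3 G H (initial_position 3 G H)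
    (c, inl set0).
  (* The opening marks all of [G]; a reply other than all of [H] would leave unmarked vertices in
     [H] only. *)
  apply: (@winning_left _ _ _ _ c setT) => B; apply: winning_alive => al.
  have defB := alive_setT al (recolour_same _ c _).
  rewrite /= recolour_same in defB.
  apply: (@winning_induced _ _ _ _ c d e hRC) => //.
  rewrite /= !recolour_same defB => iso; apply: hGH.
  apply: isomorphic_trans (induced_setT G) _; apply: isomorphic_trans iso _.
  exact/isomorphic_sym/induced_setT.
by exists s => p [p0 play]; apply: win_s p0 play.
Qed.
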